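(* Let $p$ be an odd prime and $m,s,\eta$ positive integers. Let $\lambda,\xi,\psi\in\mathbb{F}_{p^m}\setminus\{0\}$ be such that $\lambda=\psi^{p^s}$. Suppose that $x^{2\eta}-\psi$ factors into two irreducible polynomials over $\mathbb{F}_{p^m}$ as $x^{2\eta}-\psi=(x^\eta-\xi)(x^\eta+\xi)$. Then all $\lambda$-cyclic codes of length $2\eta p^s$ over $\mathbb{F}_{p^m}$ are of the form $C=\langle(x^\eta-\xi)^i(x^\eta+\xi)^j\rangle\subset\mathbb{F}_{p^m}[x]/\langle x^{2\eta p^s}-\lambda\rangle$, where $0\le i,j\le p^s$ are integers. If $(i,j)=(0,0)$, then $C$ is the whole space $\mathbb{F}_{p^m}^{2\eta p^s}$, and if $(i,j)=(p^s,p^s)$, then $C$ is the zero space. For the remaining values of $(i,j)$, the Hamming distance of $C$ is as follows, where $1\le\beta'\le\beta\le p-2$, $1\le\tau^{(2)}<\tau^{(1)}\le p-1$, $1\le\tau,\tau^{(3)},\tau^{(4)}\le p-1$, $1\le k\le s-1$, $1\le k''<k'\le s-1$ are integers, and where in every case except cases 2 and 7 the same value also holds with the roles of $i$ and $j$ interchanged: 1. $0<i\le p^s$, $j=0$: $d_H(C)=2$. 2. $0\le i\le p^{s-1}$, $0\le j\le p^{s-1}$: $d_H(C)=2$. 3. $p^{s-1}<i\le2p^{s-1}$, $0<j\le p^{s-1}$: $d_H(C)=3$. 4. $2p^{s-1}<i\le p^s$, $0<j\le p^{s-1}$: $d_H(C)=4$. 5. $\beta p^{s-1}+1\le i\le(\beta+1)p^{s-1}$,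 $\beta'p^{s-1}+1\le j\le(\beta'+1)p^{s-1}$: $d_H(C)=\min\{\beta+2,2(\beta'+2)\}$. 6. $p^s-p^{s-k}+(\tau-1)p^{s-k-1}+1\le i\le p^s-p^{s-k}+\tau p^{s-k-1}$, $\beta p^{s-1}+1\le j\le(\beta+1)p^{s-1}$: $d_H(C)=2(\beta+2)$. 7. $p^s-p^{s-k}+(\tau-1)p^{s-k-1}+1\le i\le p^s-p^{s-k}+\tau p^{s-k-1}$, $p^s-p^{s-k}+(\tau-1)p^{s-k-1}+1\le j\le p^s-p^{s-k}+\tau p^{s-k-1}$: $d_H(C)=(\tau+1)p^k$. 8. $p^s-p^{s-k}+(\tau^{(1)}-1)p^{s-k-1}+1\le i\le p^s-p^{s-k}+\tau^{(1)}p^{s-k-1}$, $p^s-p^{s-k}+(\tau^{(2)}-1)p^{s-k-1}+1\le j\le p^s-p^{s-k}+\tau^{(2)}p^{s-k-1}$: $d_H(C)=\min\{2(\tau^{(2)}+1)p^k,(\tau^{(1)}+1)p^k\}$. 9. $p^s-p^{s-k'}+(\tau^{(3)}-1)p^{s-k'-1}+1\le i\le p^s-p^{s-k'}+\tau^{(3)}p^{s-k'-1}$, $p^s-p^{s-k''}+(\tau^{(4)}-1)p^{s-k''-1}+1\le j\le p^s-p^{s-k''}+\tau^{(4)}p^{s-k''-1}$: $d_H(C)=2(\tau^{(4)}+1)p^{k''}$. 10. $i=p^s$, $\beta p^{s-1}+1\le j\le(\beta+1)p^{s-1}$: $d_H(C)=2(\beta+2)$. 11. $i=p^s$, $p^s-p^{s-k}+(\tau-1)p^{s-k-1}+1\le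 j\le p^s-p^{s-k}+\tau p^{s-k-1}$: $d_H(C)=2(\tau+1)p^k$.
   Context: A linear code over $\mathbb{F}_{p^m}$ of length $N$ is $\lambda$-cyclic if it is closed under $(c_0,\dots,c_{N-1})\mapsto(\lambda c_{N-1},c_0,\dots,c_{N-2})$; identifying codewords with polynomials of degree less than $N$, the $\lambda$-cyclic codes are exactly the ideals of $\mathbb{F}_{p^m}[x]/\langle x^N-\lambda\rangle$. The Hamming weight $w_H$ is the number of nonzero coefficients, and $d_H(C)=\min\{w_H(c):0\ne c\in C\}$. *)

(* Defs.v *)
From HB Require Import structures.
From mathcomp Require Import all_boot all_order all_algebra.
From mathcomp Require Import qpoly.

Set Implicit Arguments.
Unset Strict Implicit.
Unset Printing Implicit Defensive.

Import GRing.Theory.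
Local Open Scope ring_scope.

Section Codes.
Context {F : finFieldType} {n : nat}.
Implicit Types (c : 'rV[F]_n) (C : {set 'rV[F]_n}) (lam : F) (g : {poly F}).

(* (c_0, ..., c_{n-1}) |-> (lam * c_{n-1}, c_0, ..., c_{n-2});
   ord_pred sends 0 to n - 1. *)
Definition constashift lam c : 'rV[F]_n :=
  \row_(i < n) ((if i == 0%N :> nat then lam else 1) * c 0 (ord_pred i)).

Definition linear_code C : Prop := submod_closed (mem C).

Definition cyclic_code lam C : Prop :=
  linear_code C /\ forall c, c \in C -> constashift lam c \in C.

(* The codeword c stands for the class of sum_i c_i X^i in F[X]/<X^n - lam>.
   The type {poly %/ h} is the quotient by h only for h monic of positive
   degree, so n is meant to be positive here. *)
Definition codeword_class lam c : {poly %/ 'X^n - lam%:P} :=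
  in_qpoly ('X^n - lam%:P) (rVpoly c).

(* The principal ideal <g> of F[X]/<X^n - lam>, as a set of codewords. *)
Definition ideal_code lam g : {set 'rV[F]_n} :=
  [set c | [exists h : {poly %/ 'X^n - lam%:P},
              codeword_class lam c == h * in_qpoly ('X^n - lam%:P) g]].

Definition hamming_weight c : nat := #|[set i | c 0 i != 0]|.

(* Weights are at most n, so the default value n does not affect the minimum
   unless C has no nonzero codeword. *)
Definition hamming_distance C : nat :=
  \big[minn/n]_(c in C | c != 0) hamming_weight c.

End Codes.

(* Main.v *)
Require Import Defs.
From mathcomp Require Import all_boot all_order all_algebra.
From mathcomp Require Import qpoly finfield zify.

(** Write q = p ^ s, f = X^eta - xi and g = X^eta + xi. In characteristic p the
    modulus X^N - lam is the q-th power of X^(2 eta) - psi, that is f^q g^q. A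
    constacyclic code is an ideal of the quotient ring, hence generated by the
    gcd of its words and the modulus ([cyclic_code_divisor]); this gcd divides
    f^q g^q, so it is associated to some f^i g^j by unique factorization
    ([dvdp_exp2_irreducible]).

    For the distances, a word of the code is a multiple of f^i g^j of degree
    less than N, and its weight is its number of nonzero coefficients. Grouping
    coefficients according to the residue of their index modulo n writes a
    polynomial as the sum of the X^r c_r(X^n) for r < n; weights add up, and
    h(X^n) divides c exactly when h divides every c_r ([weight_stride],
    [dvdp_stride]). This decomposition is used three times.

    With n = eta it replaces f^i g^j by (X - xi)^i (X + xi)^j and N by 2 q.

    With n = 2 it separates the two roots xi and - xi, whose common square
    is xi^2. Let P(i) be the least weight of a nonzero multiple of (X - a)^i of
    degree less than q, for a nonzero a; it is nondecreasing in i and does not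
    depend on a. Let j <= i. If both the even and the odd part of a word are
    nonzero, each is a multiple of (Y - xi^2)^j, where Y = X^2, so the weight is
    at least 2 P(j). If one vanishes, the symmetry X -> - X makes the other a
    multiple of (Y - xi^2)^i, and the weight is at least P(i). Both bounds are
    attained, by a word in X^2 and by a multiple of the binomial
    (X - xi)^q = X^q - xi^q. So the distance is the minimum of P(i) and 2 P(j)
    ([min_weight_two_roots]), the first being absent when i = q.

    With n = p^(s-1) it computes P by peeling off the leading base p digit of
    the multiplicity ([top_digit], [min_weight_ge_power]); for multiplicities
    less than p, a polynomial of degree less than p with a nonzero root of
    multiplicity v has weight larger than v, by differentiation
    ([ltn_weight_small]). Products of binomial powers reach the bound
    ([min_weight_le_power]). The value is P(i) = (t + 1) p^k on the k-th range
    with index t of the statement, and (b + 2) on the block with index b, which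
    is the range k = 0, t = b + 1. All the listed distances follow by comparing
    P(i) with 2 P(j). *)

Set Implicit Arguments.
Unset Strict Implicit.
Unset Printing Implicit Defensive.

Import GRing.Theory.
Local Open Scope ring_scope.

(** * Weights and residue classes of exponents *)

Definition weight (F : fieldType) (c : {poly F}) : nat :=
  (\sum_(i < size c) (c`_i != 0)%R)%N.

(** The component c_r of the decomposition of c as the sum of the X^r c_r(X^n)
    over r < n, which [stride_sum] states. *)
Definition stride (F : fieldType) (n r : nat) (c : {poly F}) : {poly F} :=
  \poly_(l < size c) c`_(l * n + r).

Section Weight.
Variable F : fieldType.
Implicit Types (c d h : {poly F}).

Lemma weightE n c : (size c <= n)%N -> weight c = (\sum_(i < n) (c`_i != 0)%R)%N.
Proof.
move=> le_cn; rewrite /weight.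
rewrite (big_ord_widen n (fun i => (c`_i != 0) : nat) le_cn) big_mkcond /=.
by apply: eq_bigr => i _; case: ltnP => // /(nth_default 0) ->; rewrite eqxx.
Qed.

Lemma weight0 : weight (0 : {poly F}) = 0%N.
Proof. by rewrite /weight size_poly0 big_ord0. Qed.

Lemma weight_eq0 c : (weight c == 0%N) = (c == 0).
Proof.
apply/idP/eqP=> [|->]; last by rewrite weight0.
rewrite sum_nat_eq0 => /forallP w0; apply/polyP=> i; rewrite coef0.
case: (ltnP i (size c)) => [lt_ic|]; last exact: nth_default.
by have := w0 (Ordinal lt_ic); rewrite /= eqb0 negbK => /eqP.
Qed.

Lemma weight_gt0 c : (0 < weight c)%N = (c != 0).
Proof. by rewrite lt0n weight_eq0. Qed.

Lemma weight_le_size c : (weight c <= size c)%N.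
Proof.
rewrite /weight -[X in (_ <= X)%N]card_ord -sum1_card.
by apply: leq_sum => i _; apply: leq_b1.
Qed.

Lemma weight_add c d : (weight (c + d) <= weight c + weight d)%N.
Proof.
pose n := maxn (size c) (size d).
rewrite (@weightE n) ?size_polyD //.
rewrite (@weightE n c) ?leq_maxl // (@weightE n d) ?leq_maxr // -big_split /=.
apply: leq_sum => i _; rewrite coefD.
have [->|_] := eqVneq c`_i 0; first by rewrite add0r add0n.
by rewrite (leq_trans (leq_b1 _)).
Qed.

Lemma weight_sum I (r : seq I) (f : I -> {poly F}) :
  (weight (\sum_(i <- r) f i) <= \sum_(i <- r) weight (f i))%N.
Proof.
elim: r => [|x r IHr]; first by rewrite !big_nil weight0.
by rewrite !big_cons (leq_trans (weight_add _ _)) ?leq_add2l.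
Qed.

Lemma weight_scale (a : F) c : (weight (a *: c) <= (a != 0)%R * weight c)%N.
Proof.
have [->|a_neq0] := eqVneq a 0; first by rewrite scale0r weight0.
rewrite mul1n (@weightE (size c)) ?size_scale_leq //.
by apply: leq_sum => i _; rewrite coefZ mulf_eq0 (negPf a_neq0).
Qed.

Lemma weight_mulXn n c : weight ('X^n * c) = weight c.
Proof.
rewrite (@weightE (n + size c)); last first.
  by rewrite (leq_trans (size_polyMleq _ _)) // size_polyXn.
rewrite big_split_ord /= big1 ?add0n; last first.
  by move=> i _; rewrite coefXnM ltn_ord eqxx.
by apply: eq_bigr => i _; rewrite coefXnM ltnNge leq_addr /= addKn.
Qed.

Lemma weight_mul c d : (weight (c * d) <= weight c * weight d)%N.
Proof.
rewrite -{1}[c]coefK poly_def mulr_suml (leq_trans (weight_sum _ _)) //.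
rewrite /weight big_distrl /=; apply: leq_sum => i _.
by rewrite -scalerAl (leq_trans (weight_scale _ _)) // weight_mulXn.
Qed.

Lemma coef_stride n r c l : (0 < n)%N -> (stride n r c)`_l = c`_(l * n + r).
Proof.
move=> n_gt0; rewrite coef_poly; case: ltnP => // le_cl.
by rewrite nth_default // (leq_trans le_cl) // (leq_trans (leq_pmulr l n_gt0)) ?leq_addr.
Qed.

Lemma size_stride n r K c : (0 < n)%N -> (size c <= K * n)%N ->
  (size (stride n r c) <= K)%N.
Proof.
move=> n_gt0 le_cK; apply/leq_sizeP => l le_Kl; rewrite coef_stride //.
rewrite nth_default // (leq_trans le_cK) // (leq_trans _ (leq_addr _ _)) //.
by rewrite leq_mul2r le_Kl orbT.
Qed.

Lemma weight_stride n c : (0 < n)%N ->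
  weight c = (\sum_(r < n) weight (stride n r c))%N.
Proof.
move=> n_gt0; pose K := size c.
have le_cK: (size c <= K * n)%N by apply: leq_pmulr.
under eq_bigr => r _ do rewrite (@weightE K) ?size_stride //.
rewrite exchange_big /= (weightE le_cK).
rewrite -(big_mkord xpredT (fun i => (c`_i != 0) : nat)) big_nat_mul big_mkord.
apply: eq_bigr => l _; rewrite -{1}[(l * n)%N]add0n mulSn big_addn addnK big_mkord.
by apply: eq_bigr => r _; rewrite coef_stride // addnC.
Qed.

(** Multiplication by h(X^n) acts separately on each residue class of exponents,
    since F[X] is a free module over F[X^n] with basis the X^r for r < n. *)
Lemma stride_comp_mul n r h c : (r < n)%N ->
  stride n r ((h \Po 'X^n) * c) = h * stride n r c.
Proof.
move=> lt_rn; have n_gt0: (0 < n)%N by apply: leq_trans lt_rn.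
elim/poly_ind: h => [|h a IHh].
  by rewrite comp_poly0 !mul0r; apply/polyP=> l; rewrite coef_stride // !coef0.
apply/polyP=> l; rewrite coef_stride // comp_poly_MXaddC !mulrDl !coefD.
rewrite !coefCM coef_stride //; congr (_ + _).
rewrite -!mulrA ['X^n * _]mulrC ['X * _]mulrC !mulrA coefMX coefMXn.
case: l => [|l]; first by rewrite lt_rn.
rewrite -IHh coef_stride // mulSn -addnA ltnNge leq_addr /=.
by rewrite addKn.
Qed.

Lemma stride_sum n c : (0 < n)%N ->
  c = \sum_(r < n) 'X^r * (stride n r c \Po 'X^n).
Proof.
move=> n_gt0; apply/polyP=> i; rewrite coef_sum.
rewrite (bigD1 (Ordinal (ltn_pmod i n_gt0))) //= [X in _ + X]big1 => [|r r_neq].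
  rewrite addr0 coefXnM ltnNge leq_mod /= coef_comp_poly_Xn //.
  have ->: (i - i %% n = i %/ n * n)%N by rewrite {1}(divn_eq i n) addnK.
  rewrite dvdn_mull // mulnK // coef_stride //.
  by rewrite -divn_eq.
rewrite coefXnM; case: ltnP => // le_ri; rewrite coef_comp_poly_Xn //.
case: ifP => // dv; case/negP: r_neq; apply/eqP/val_inj => /=.
by rewrite -(subnK le_ri) -modnDml (eqP dv) add0n modn_small.
Qed.

Lemma dvdp_stride n r h c : (r < n)%N ->
  (h \Po 'X^n) %| c -> h %| stride n r c.
Proof.
move=> lt_rn /dvdpP[q ->]; rewrite mulrC stride_comp_mul //; exact: dvdp_mulr.
Qed.

Lemma exists_stride_neq0 n c : (0 < n)%N -> c != 0 ->
  exists2 r : 'I_n, stride n r c != 0 & (weight (stride n r c) <= weight c)%N.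
Proof.
move=> n_gt0 c_neq0; have: weight c != 0%N by rewrite weight_eq0.
rewrite (weight_stride _ n_gt0) sum_nat_eq0 negb_forall => /existsP[r nz].
exists r; first by rewrite -weight_eq0.
by rewrite (bigD1 r) //= leq_addr.
Qed.

Lemma weight_comp_Xn n c : (0 < n)%N -> weight (c \Po 'X^n) = weight c.
Proof.
move=> n_gt0; rewrite (weight_stride _ n_gt0) -[c \Po _]mulr1.
have strideE (r : 'I_n): stride n r ((c \Po 'X^n) * 1) = c * (r == 0%N :> nat)%:R.
  rewrite stride_comp_mul //; congr (_ * _); apply/polyP=> l.
  rewrite coef_stride // coef1 addn_eq0 muln_eq0 (gtn_eqF n_gt0) orbF.
  by case: (r == 0%N :> nat); rewrite ?andbT ?andbF ?coef1 ?coef0.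
under eq_bigr => r _ do rewrite strideE.
rewrite (bigD1 (Ordinal n_gt0)) //= mulr1 big1 ?addn0 // => r.
by rewrite -val_eqE /= => /negPf->; rewrite mulr0 weight0.
Qed.

End Weight.

(** * Multiples of a power of one linear factor *)

Section RepeatedRoot.
Variables (F : fieldType) (p : nat).
Hypothesis pcharF : p \in [pchar F].
Implicit Types (c d h : {poly F}) (a b : F).

Let p_prime : prime p := pcharf_prime pcharF.
Let p_gt1 : (1 < p)%N := prime_gt1 p_prime.

Lemma Frobenius_polyB h d n : (h - d) ^+ (p ^ n) = h ^+ (p ^ n) - d ^+ (p ^ n).
Proof.
have pnat: [pchar {poly F}].-nat (p ^ n)%N.
  by rewrite pnatX pnatE // pchar_poly pcharF.
by rewrite exprDn_pchar // exprNn_pchar.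
Qed.

Lemma XsubC_exp_Frobenius a n v :
  ('X - a%:P) ^+ (p ^ n * v)
    = (('X - (a ^+ (p ^ n))%:P) ^+ v) \Po 'X^(p ^ n).
Proof.
by rewrite exprM Frobenius_polyB rmorphXn /= comp_polyB comp_polyX comp_polyC -polyC_exp.
Qed.

(** Up to dividing by X, which is invertible modulo X - a, the constant
    coefficient is nonzero. Differentiation then kills exactly that coefficient,
    the other exponents being nonzero modulo p, and lowers the multiplicity of
    the root by at most one. *)
Lemma ltn_weight_small c a v : a != 0 -> c != 0 -> (size c <= p)%N ->
  ('X - a%:P) ^+ v %| c -> (v < weight c)%N.
Proof.
move=> a_neq0; have [n] := ubnP (size c); elim: n => // n IHn in c v *.
rewrite ltnS => le_cn c_neq0 le_cp dv.
have [c0|c0_neq0] := eqVneq c`_0 0.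
  have /factor_theorem[c1 c1E] : root c 0 by rewrite rootE horner_coef0 c0.
  rewrite subr0 mulrC in c1E; have c1_neq0: c1 != 0.
    by apply: contraNneq c_neq0; rewrite c1E => ->; rewrite mulr0.
  have sc: size c = (size c1).+1 by rewrite c1E mulrC size_mulX.
  rewrite c1E -['X]expr1 weight_mulXn.
  apply: (IHn c1) => //; [by rewrite -sc | by rewrite ltnW // -sc |].
  move: dv; rewrite c1E Gauss_dvdpr // coprimep_expl //.
  by rewrite coprimepX root_XsubC eq_sym.
case: v dv => [|v] dv; first by rewrite weight_gt0.
have dv' : ('X - a%:P) ^+ v %| c^`().
  case/dvdpP: dv => q ->; rewrite derivM deriv_exp derivXsubC mul1r /=.
  rewrite dvdp_add //; first by rewrite exprS mulrA dvdp_mull.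
  by rewrite dvdp_mull // -mulr_natr dvdp_mulr.
have sc : (0 < size c)%N by rewrite size_poly_gt0.
have ndv (j : nat) : (j.+1 < p)%N -> (j.+1%:R : F) != 0.
  move=> lt_jp; rewrite -(dvdn_pcharf pcharF) gtnNdvd //.
have dc_neq0 : c^`() != 0.
  apply/negP => /eqP dc0.
  have /size1_polyC cE : (size c <= 1)%N.
    apply/leq_sizeP => -[//|j] _; case: (ltnP j.+1 (size c)); last exact: nth_default.
    move=> lt_jc; move/polyP: dc0 => /(_ j); rewrite coef_deriv coef0 => /eqP.
    by rewrite -mulr_natr mulf_eq0 (negPf (ndv _ (leq_trans lt_jc le_cp))) orbF => /eqP.
  have := dvdp_leq c_neq0 dv; rewrite size_exp_XsubC cE size_polyC.
  by case: (_ != 0).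
have lt_w : (weight c^`() < weight c)%N.
  rewrite (weightE (leqSpred (size c))) (@weightE _ (size c).-1); last first.
    by rewrite -ltnS prednK // lt_size_deriv.
  rewrite big_ord_recl c0_neq0 ltnS; apply: leq_sum => j _.
  rewrite coef_deriv lift0 -mulr_natr mulf_eq0 negb_or.
  by case: (c`_j.+1 == 0); rewrite //= leq_b1.
apply: leq_ltn_trans lt_w; apply: IHn => //; have := lt_size_deriv c_neq0.
  by move=> h; apply: leq_trans le_cn.
by move=> h; apply: leq_trans le_cp; apply: ltnW.
Qed.

(** Let Q = p ^ s, and let v be the least multiplicity of a ^ Q as a root of one
    of the components c_r of c modulo Q. Then c = (X - a)^(Q v) e, where e is the
    sum of the X^r u_r(X^Q) and some u_r does not vanish at a ^ Q. Modulo
    (X - a)^Q = X^Q - a^Q this e is the polynomial d with coefficients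
    u_r(a ^ Q), so that d carries the rest of the multiplicity, while every
    nonzero coefficient of d comes from a component c_r of weight larger
    than v. Here v is the leading base p digit of the multiplicity of a. *)
Lemma top_digit c a s i : a != 0 -> c != 0 -> (size c <= p ^ s.+1)%N ->
    ('X - a%:P) ^+ i %| c ->
  exists v d, [/\ (v < p)%N, d != 0, (size d <= p ^ s)%N,
    ('X - a%:P) ^+ (i - p ^ s * v) %| d & (v.+1 * weight d <= weight c)%N].
Proof.
set Q := (p ^ s)%N => a_neq0 c_neq0 le_c dvdc.
have Q_gt0 : (0 < Q)%N by rewrite expn_gt0 prime_gt0.
pose b := a ^+ Q; have b_neq0 : b != 0 by rewrite expf_neq0.
pose f := 'X - b%:P; pose P w := [forall r : 'I_Q, f ^+ w %| stride Q r c].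
have le_stride r : (size (stride Q r c) <= p)%N.
  by rewrite size_stride // -expnS.
have P0 : exists w, P w by exists 0%N; apply/forallP => r; rewrite expr0 dvd1p.
have P_lt w : P w -> (w < p)%N.
  move=> /forallP Pw; have [r r_neq0 _] := exists_stride_neq0 Q_gt0 c_neq0.
  apply: leq_trans (leq_trans (weight_le_size _) (le_stride r)).
  exact: ltn_weight_small b_neq0 r_neq0 (le_stride r) (Pw r).
have P_ub w : P w -> (w <= p)%N by move/P_lt/ltnW.
have [v Pv v_max] := ex_maxnP P0 P_ub.
pose u r := stride Q r c %/ f ^+ v.
have uE (r : 'I_Q) : stride Q r c = f ^+ v * u r.
  by rewrite mulrC divpK // (forallP Pv).
pose d := \poly_(r < Q) (u r).[b].
pose e := \sum_(r < Q) 'X^r * (u r \Po 'X^Q).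
have cE : c = ('X - a%:P) ^+ (Q * v) * e.
  rewrite {1}(stride_sum c Q_gt0) big_distrr /=; apply: eq_bigr => r _.
  by rewrite uE comp_polyM -XsubC_exp_Frobenius mulrCA.
have d_neq0 : d != 0.
  apply/negP => /eqP d0; suff /v_max : P v.+1 by rewrite ltnn.
  apply/forallP => r; rewrite uE exprSr dvdp_mul2l ?expf_neq0 ?polyXsubC_eq0 //.
  rewrite dvdp_XsubCl rootE; move/polyP: d0 => /(_ r).
  by rewrite coef_poly ltn_ord coef0 => ->.
have le_d : (size d <= Q)%N by apply: size_poly.
exists v, d; split => //; first exact: P_lt.
  have dvd_ed : ('X - a%:P) ^+ Q %| e - d.
    rewrite [d]poly_def -sumrB; elim/big_rec: _ => [|r x _ dvd_x].
      exact: dvdp0.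
    rewrite dvdp_add // -mul_polyC [_%:P * _]mulrC -mulrBr dvdp_mull //.
    have /(dvdp_comp_poly 'X^Q) : f %| u r - (u r).[b]%:P.
      by rewrite dvdp_XsubCl rootE !hornerE subrr.
    by rewrite -[f]expr1 -XsubC_exp_Frobenius muln1 comp_polyB comp_polyC.
  pose l := minn (i - Q * v) Q.
  have dvd_e : ('X - a%:P) ^+ l %| e.
    apply: dvdp_trans (dvdp_exp2l _ (geq_minl _ _)) _.
    case: (leqP i (Q * v)) => [|/ltnW le_i].
      by rewrite -subn_eq0 => /eqP->; rewrite expr0 dvd1p.
    move: dvdc; rewrite {1}cE -{1}(subnKC le_i) exprD dvdp_mul2l //.
    by rewrite expf_neq0 ?polyXsubC_eq0.
  have dvd_d : ('X - a%:P) ^+ l %| d.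
    rewrite -(dvdp_subr _ dvd_e); apply: dvdp_trans dvd_ed.
    exact: dvdp_exp2l (geq_minr _ _).
  case: (leqP (i - Q * v) Q) => [le_iQ|/ltnW le_Qi].
    by move: dvd_d; rewrite /l (minn_idPl le_iQ).
  have := dvdp_leq d_neq0 dvd_d; rewrite /l (minn_idPr le_Qi) size_exp_XsubC.
  by rewrite ltnNge le_d.
rewrite (weight_stride c Q_gt0) (weightE le_d) big_distrr /=.
apply: leq_sum => r _; rewrite coef_poly ltn_ord.
case: eqVneq => [|ub_neq0]; first by rewrite muln0.
have r_neq0 : stride Q r c != 0.
  apply: contraNneq ub_neq0; rewrite uE => /eqP.
  by rewrite mulf_eq0 expf_eq0 polyXsubC_eq0 andbF /= => /eqP->; rewrite horner0.
by rewrite muln1; exact: ltn_weight_small b_neq0 r_neq0 (le_stride r) (forallP Pv r).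
Qed.

(** A polynomial of weight 1 is a monomial, whose only possible root is 0. *)
Lemma weight_gt1 c a : a != 0 -> c != 0 -> root c a -> (1 < weight c)%N.
Proof.
move=> a_neq0 c_neq0 /rootP ca0; rewrite ltnNge; apply/negP => le_w1.
have sc : size c = (size c).-1.+1 by rewrite prednK // size_poly_gt0.
move: le_w1; rewrite /weight sc big_ord_recr /= -lead_coefE lead_coef_eq0 c_neq0.
rewrite addn1 ltnS leqn0 sum_nat_eq0 => /forallP low0.
move: ca0; rewrite horner_coef sc big_ord_recr /= big1 ?add0r => [|i _].
  move/eqP; rewrite mulf_eq0 -lead_coefE lead_coef_eq0 expf_eq0.
  by rewrite (negPf c_neq0) (negPf a_neq0) andbF.
by have := low0 i; rewrite /= eqb0 negbK => /eqP->; rewrite mul0r.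
Qed.

(** The two bounds are kept apart because the lower one holds vacuously, for
    every v, when h has no nonzero multiple of size at most n. *)
Definition min_weight_ge n h v :=
  forall c, c != 0 -> (size c <= n)%N -> h %| c -> (v <= weight c)%N.

Definition min_weight_le n h v :=
  exists c, [/\ c != 0, (size c <= n)%N, h %| c & (weight c <= v)%N].

(** Induction on s through [top_digit]. For k > 0 the leading digit of i has to be
    p - 1, and contributes a factor p. For k = 0 it is at least t - 1; if it
    equals t - 1, some multiplicity remains, and the remaining factor has weight
    at least 2. The value t = p is allowed: it covers, for k = 0, all
    multiplicities with leading digit p - 1. *)
Lemma min_weight_ge_power a s k t i : a != 0 -> (k < s)%N -> (0 < t <= p)%N ->
    (p ^ s - p ^ (s - k) + (t - 1) * p ^ (s - k - 1) < i)%N ->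
  min_weight_ge (p ^ s) (('X - a%:P) ^+ i) ((t + 1) * p ^ k).
Proof.
move=> a_neq0; elim: s => // s IHs in k i *.
move=> lt_ks /andP[t_gt0 le_tp] lt_i c c_neq0 le_c dvdc.
have [v [d [lt_vp d_neq0 le_d dvdd le_w]]] := top_digit a_neq0 c_neq0 le_c dvdc.
have Q_gt0 : (0 < p ^ s)%N by rewrite expn_gt0 prime_gt0.
have lt_i_top : (i < p ^ s * v.+1)%N.
  have := leq_trans (dvdp_leq d_neq0 dvdd) le_d; rewrite size_exp_XsubC mulnS.
  lia.
apply: leq_trans le_w; case: k => [|k] in lt_ks lt_i *.
  rewrite !subn0 !subn1 /= subnn add0n in lt_i; rewrite expn0 muln1.
  have le_tv : (t <= v.+1)%N.
    have := ltn_trans lt_i lt_i_top; rewrite mulnC ltn_pmul2l //; lia.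
  have [lt_vt|le_tv'] := ltnP v t; last first.
    by rewrite -[(t + 1)%N]muln1 leq_mul ?weight_gt0 // addn1.
  have tE : t = v.+1 by apply/eqP; rewrite eqn_leq le_tv.
  have w_gt1 : (1 < weight d)%N.
    apply: (weight_gt1 a_neq0 d_neq0); rewrite -dvdp_XsubCl -['X - _]expr1.
    apply: dvdp_trans dvdd; apply: dvdp_exp2l.
    by rewrite subn_gt0; move: lt_i; rewrite tE mulnC.
  by apply: leq_trans (leq_mul (leqnn _) w_gt1); rewrite tE; lia.
have lt_pQ : (p ^ (s - k) <= p ^ s)%N by rewrite leq_exp2l // leq_subr.
rewrite subSS expnS in lt_i.
have vE : v.+1 = p.
  have : ((p - 1) * p ^ s < v.+1 * p ^ s)%N.
    rewrite mulnBl mul1n [(v.+1 * _)%N]mulnC; move: lt_i lt_i_top lt_pQ.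
    set A := (p * p ^ s)%N; set B := (p ^ s * v.+1)%N.
    set D := (p ^ (s - k))%N; set E := ((t - 1) * _)%N; set Q := (p ^ s)%N; lia.
  by rewrite ltn_pmul2r //; lia.
rewrite vE expnS mulnCA leq_pmul2l ?prime_gt0 //.
apply: (IHs k (i - p ^ s * v)%N) => //; first by rewrite t_gt0.
have -> : (p ^ s * v = p * p ^ s - p ^ s)%N by rewrite -vE mulSn mulnC; lia.
have : (p ^ s <= p * p ^ s)%N by rewrite leq_pmull // prime_gt0.
lia.
Qed.

(** There is no nonzero polynomial to bound, for degree reasons. This lets the
    exponent p ^ s be treated as a multiplicity with infinite minimal weight. *)
Lemma min_weight_ge_top a s v : min_weight_ge (p ^ s) (('X - a%:P) ^+ (p ^ s)) v.
Proof.
move=> c c_neq0 le_c /(dvdp_leq c_neq0); rewrite size_exp_XsubC.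
by move/leq_trans/(_ le_c); rewrite ltnn.
Qed.

Lemma weight_XsubC_exp a n v : (weight (('X - a%:P) ^+ (p ^ n * v)) <= v.+1)%N.
Proof.
rewrite XsubC_exp_Frobenius weight_comp_Xn ?expn_gt0 ?prime_gt0 //.
by rewrite (leq_trans (weight_le_size _)) // size_exp_XsubC.
Qed.

(** The exponent is p^(s-k-1) t + p^(s-k) (p^k - 1): the power of X - a is the
    product of the t-th power of one binomial and the (p^k - 1)-th power of
    another, and weights are submultiplicative. *)
Lemma min_weight_le_power a s k t : (k < s)%N -> (t < p)%N ->
  min_weight_le (p ^ s)
    (('X - a%:P) ^+ (p ^ s - p ^ (s - k) + t * p ^ (s - k - 1))) ((t + 1) * p ^ k).
Proof.
move=> lt_ks lt_tp; set T := (_ + _)%N.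
have skE : (s - k = (s - k - 1).+1)%N by lia.
have le_pQ : (p ^ (s - k) <= p ^ s)%N by rewrite leq_exp2l // leq_subr.
have lt_tP : (t * p ^ (s - k - 1) < p ^ (s - k))%N.
  by rewrite [X in (_ < p ^ X)%N]skE expnS ltn_pmul2r // expn_gt0 prime_gt0.
exists (('X - a%:P) ^+ T); split; rewrite ?expf_neq0 ?polyXsubC_eq0 //.
  by rewrite size_exp_XsubC /T; lia.
have -> : T = (p ^ (s - k - 1) * t + p ^ (s - k) * (p ^ k - 1))%N.
  by rewrite /T mulnBr muln1 -expnD subnK 1?ltnW // addnC [(t * _)%N]mulnC.
rewrite exprD (leq_trans (weight_mul _ _)) // leq_mul //.
  by rewrite addn1 weight_XsubC_exp.
by rewrite (leq_trans (weight_XsubC_exp _ _ _)) // subn1 prednK ?expn_gt0 ?prime_gt0.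
Qed.

End RepeatedRoot.

(** * Substituting a power of the variable *)

Lemma size_comp_Xn_leq (F : fieldType) (c : {poly F}) n k : (0 < k)%N ->
  (size c <= n)%N -> (size (c \Po 'X^k) <= n * k)%N.
Proof.
move=> k_gt0 le_cn; have [->|c_neq0] := eqVneq c 0.
  by rewrite comp_poly0 size_poly0.
have sc : (0 < size c)%N by rewrite size_poly_gt0.
rewrite (leq_trans (size_comp_poly_leq _ _)) // size_polyXn /=.
apply: leq_trans (leq_mul le_cn (leqnn k)).
by rewrite -[X in (_ <= X * _)%N](prednK sc) mulSn -addn1 addnC leq_add2r.
Qed.

Lemma comp_Xn_neq0 (F : fieldType) (c : {poly F}) k : (0 < k)%N ->
  (c \Po 'X^k != 0) = (c != 0).
Proof. by move=> k_gt0; rewrite comp_poly_eq0 // size_polyXn ltnS. Qed.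

Lemma min_weight_ge_comp_Xn (F : fieldType) n k (h : {poly F}) v : (0 < k)%N ->
  min_weight_ge n h v -> min_weight_ge (n * k) (h \Po 'X^k) v.
Proof.
move=> k_gt0 ge_v c c_neq0 le_c dvdc.
have [r r_neq0 le_r] := exists_stride_neq0 k_gt0 c_neq0.
apply: leq_trans le_r; apply: ge_v => //; first exact: size_stride.
exact: dvdp_stride.
Qed.

Lemma min_weight_le_comp_Xn (F : fieldType) n k (h : {poly F}) v : (0 < k)%N ->
  min_weight_le n h v -> min_weight_le (n * k) (h \Po 'X^k) v.
Proof.
move=> k_gt0 [c [c_neq0 le_c dvdc le_v]]; exists (c \Po 'X^k); split.
- by rewrite comp_Xn_neq0.
- exact: size_comp_Xn_leq.
- exact: dvdp_comp_poly.
- by rewrite weight_comp_Xn.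
Qed.

Lemma min_weight_le_dvdp (F : fieldType) n (h h' : {poly F}) v :
  h %| h' -> min_weight_le n h' v -> min_weight_le n h v.
Proof.
by move=> dv [c [c_neq0 le_c /(dvdp_trans dv)]]; exists c; split.
Qed.

(** * Two opposite roots *)

Section TwoRoots.
Variables (F : fieldType) (xi : F).
Hypotheses (xi_neq0 : xi != 0) (two_neq0 : 2%:R != 0 :> F).
Implicit Types h : {poly F}.

Lemma XsubC_sqr_comp : ('X - (xi ^+ 2)%:P) \Po 'X^2 = ('X - xi%:P) * ('X + xi%:P).
Proof. by rewrite comp_polyB comp_polyX comp_polyC polyC_exp subr_sqr. Qed.

(** An even polynomial is invariant under X -> - X, so it is divisible by
    (X + xi)^i as well, and the two factors are coprime. *)
Lemma dvdp_even_part h i :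
  ('X - xi%:P) ^+ i %| h \Po 'X^2 -> ('X - (xi ^+ 2)%:P) ^+ i %| h.
Proof.
move=> dvd_m; have dvd_p : ('X + xi%:P) ^+ i %| h \Po 'X^2.
  have := dvdp_comp_poly (- 'X) dvd_m.
  rewrite -comp_polyA comp_Xn_poly sqrrN rmorphXn /=.
  rewrite comp_polyB comp_polyX comp_polyC -opprD exprNn.
  by apply: dvdp_trans; apply: dvdp_mulIr.
have cop : coprimep (('X - xi%:P) ^+ i) (('X + xi%:P) ^+ i).
  rewrite coprimep_expl // coprimep_expr // coprimep_sym.
  by rewrite coprimep_XsubC rootE !hornerE -mulr2n -mulr_natr mulf_neq0.
have := Gauss_dvdp (h \Po 'X^2) cop; rewrite dvd_m dvd_p /= -exprMn -XsubC_sqr_comp.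
rewrite -rmorphXn /= => /(dvdp_stride (isT : (0 < 2)%N)).
rewrite -[h \Po _]mulr1 stride_comp_mul // => dv; apply: dvdp_trans dv _.
have -> : stride 2 0 1 = 1 :> {poly F}.
  apply/polyP=> l; rewrite coef_stride // !coef1 addn0; by case: l.
by rewrite mulr1.
Qed.

(** If the even and the odd part are both nonzero, each is a multiple of
    (Y - xi^2)^(min i j) for Y = X^2 and has weight at least w, which gives 2 w;
    otherwise the nonzero part is a multiple of (Y - xi^2)^i, which gives u. The
    hypothesis w <= u stands for j <= i; it avoids comparing exponents that lie in
    the same range. *)
Lemma min_weight_ge_two_roots q i j u w : (w <= u)%N ->
    min_weight_ge q (('X - (xi ^+ 2)%:P) ^+ i) u ->
    min_weight_ge q (('X - (xi ^+ 2)%:P) ^+ j) w ->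
  min_weight_ge (2 * q) (('X - xi%:P) ^+ i * ('X + xi%:P) ^+ j) (minn u (2 * w)).
Proof.
move=> le_wu ge_u ge_w c c_neq0 le_c dvdc.
have dvd_i : ('X - xi%:P) ^+ i %| c by apply: dvdp_trans dvdc; apply: dvdp_mulr.
have dvd_j : ('X + xi%:P) ^+ j %| c by apply: dvdp_trans dvdc; apply: dvdp_mull.
have sz r : (size (stride 2 r c) <= q)%N by rewrite size_stride // mulnC.
have wE := @weight_stride F 2 c isT; rewrite !big_ord_recl big_ord0 addn0 /= in wE.
have cE := @stride_sum F 2 c isT.
rewrite !big_ord_recl big_ord0 addr0 /= expr0 mul1r expr1 in cE.
set E := stride 2 0 c in wE cE *; set O := stride 2 _ c in wE cE *.
have [E0|E_neq0] := eqVneq E 0.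
  have O_neq0 : O != 0.
    by apply: contraNneq c_neq0 => O0; rewrite cE E0 O0 !comp_poly0 mulr0 addr0.
  rewrite wE E0 weight0 add0n geq_min ge_u ?sz //; apply: dvdp_even_part.
  move: dvd_i; rewrite cE E0 comp_poly0 add0r Gauss_dvdpr // coprimep_expl //.
  by rewrite coprimepX root_XsubC eq_sym.
have [O0|O_neq0] := eqVneq O 0.
  rewrite wE O0 weight0 addn0 geq_min ge_u ?sz //; apply: dvdp_even_part.
  by move: dvd_i; rewrite {1}cE O0 comp_poly0 mulr0 addr0.
have dvd_min r : (r < 2)%N -> ('X - (xi ^+ 2)%:P) ^+ minn i j %| stride 2 r c.
  move=> lt_r2; apply: dvdp_stride => //.
  rewrite rmorphXn /= XsubC_sqr_comp exprMn; apply: dvdp_trans dvdc.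
  by apply: dvdp_mul; apply: dvdp_exp2l; rewrite ?geq_minl ?geq_minr.
have le_w r : (r < 2)%N -> stride 2 r c != 0 -> (w <= weight (stride 2 r c))%N.
  move=> /dvd_min dv nz; move: dv; case: (leqP i j) => _ dv.
    by apply: leq_trans le_wu _; apply: ge_u.
  exact: ge_w.
by rewrite geq_min wE mul2n -addnn leq_add ?orbT //; apply: le_w.
Qed.

Lemma min_weight_le_two_roots q T i j u : (i <= T)%N -> (j <= T)%N ->
    min_weight_le q (('X - (xi ^+ 2)%:P) ^+ T) u ->
  min_weight_le (2 * q) (('X - xi%:P) ^+ i * ('X + xi%:P) ^+ j) u.
Proof.
move=> le_iT le_jT /(@min_weight_le_comp_Xn _ _ 2 _ _ isT).
rewrite mulnC rmorphXn /= XsubC_sqr_comp exprMn; apply: min_weight_le_dvdp.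
by apply: dvdp_mul; apply: dvdp_exp2l.
Qed.

End TwoRoots.

(** The factor (X - xi)^i is absorbed by the binomial (X - xi)^(p ^ s) of
    weight 2. *)
Lemma min_weight_le_double (F : fieldType) (p s : nat) (xi : F) i j w :
    p \in [pchar F] -> (i <= p ^ s)%N ->
    min_weight_le (p ^ s) (('X - (- xi)%:P) ^+ j) w ->
  min_weight_le (2 * p ^ s) (('X - xi%:P) ^+ i * ('X + xi%:P) ^+ j) (2 * w).
Proof.
move=> pcharF le_iq [c [c_neq0 le_c dvdc le_w]].
rewrite polyCN opprK in dvdc.
have nz : ('X - xi%:P) ^+ (p ^ s) != 0 by rewrite expf_neq0 ?polyXsubC_eq0.
exists (('X - xi%:P) ^+ (p ^ s) * c); split.
- by rewrite mulf_neq0.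
- rewrite (leq_trans (size_polyMleq _ _)) // size_exp_XsubC.
  by rewrite mul2n -addnn addSn leq_add2l.
- by rewrite dvdp_mul // dvdp_exp2l.
- rewrite (leq_trans (weight_mul _ _)) // leq_mul //.
  by have := weight_XsubC_exp pcharF xi s 1; rewrite muln1.
Qed.

(** * Constacyclic codes as ideals *)

Lemma dvdp_exp2_irreducible (F : fieldType) (f g h : {poly F}) a b :
    irreducible_poly f -> irreducible_poly g -> h %| f ^+ a * g ^+ b ->
  exists i j, [/\ (i <= a)%N, (j <= b)%N & h %= f ^+ i * g ^+ j].
Proof.
move=> irr_f irr_g.
elim: a h => [|a IHa] h.
  elim: b h => [|b IHb] h dvd_h.
    exists 0%N, 0%N; split => //.
    by move: dvd_h; rewrite !expr0 mulr1 dvdp1 -size_poly_eq1.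
  move: IHb dvd_h; rewrite expr0 !mul1r => IHb dvd_h.
  have [dvd_gh|] := boolP (g %| h); last first.
    rewrite -irreducible_poly_coprime // coprimep_sym => cop.
    move: dvd_h; rewrite exprS (Gauss_dvdpr _ cop) => dvd_h.
    by have [i [j [? ? ?]]] := IHb h dvd_h; exists i, j; split; rewrite ?leqW.
  have g_neq0 := irredp_neq0 irr_g.
  move: dvd_h; case/dvdpP: dvd_gh => h' ->; rewrite exprSr dvdp_mul2r //.
  case/IHb=> i [j [le_i le_j eq_h]]; exists i, j.+1; split => //.
  by rewrite exprSr mulrA eqp_mul2r.
move=> dvd_h; have [dvd_fh|] := boolP (f %| h); last first.
  rewrite -irreducible_poly_coprime // coprimep_sym => cop.
  move: dvd_h; rewrite exprS -mulrA (Gauss_dvdpr _ cop) => dvd_h.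
  by have [i [j [? ? ?]]] := IHa h dvd_h; exists i, j; split; rewrite ?leqW.
have f_neq0 := irredp_neq0 irr_f.
move: dvd_h; case/dvdpP: dvd_fh => h' ->; rewrite exprSr mulrAC dvdp_mul2r //.
case/IHa=> i [j [le_i le_j eq_h]]; exists i.+1, j; split => //.
by rewrite exprSr mulrAC eqp_mul2r.
Qed.

Lemma bigminn_leq (I : eqType) (r : seq I) (P : pred I) (f : I -> nat) n x :
  x \in r -> P x -> (\big[minn/n]_(i <- r | P i) f i <= f x)%N.
Proof.
elim: r => //= y r IHr; rewrite inE big_cons => /orP[/eqP<- ->|xr Px].
  exact: geq_minl.
by case: (P y); rewrite ?geq_min IHr ?orbT.
Qed.

Section ConstacyclicCodes.
Variables (F : finFieldType) (N : nat) (lam : F).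
Hypothesis N_gt0 : (0 < N)%N.
Implicit Types (c : 'rV[F]_N) (D : {set 'rV[F]_N}) (g h : {poly F}).

Let M : {poly F} := 'X^N - lam%:P.

Let size_M : size M = N.+1. Proof. exact: size_XnsubC. Qed.
Let monic_M : M \is monic. Proof. exact: monicXnsubC. Qed.
Let M_neq0 : M != 0. Proof. exact: monic_neq0. Qed.

Lemma mk_monic_XnsubC : mk_monic M = M.
Proof. by rewrite /mk_monic size_M ltnS N_gt0 monic_M. Qed.

Lemma mem_ideal_code g c :
  g %| M -> (c \in ideal_code lam g) = (g %| rVpoly c).
Proof.
move=> dvd_gM; rewrite inE; have classE : codeword_class lam c = rVpoly c :> {poly F}.
  by rewrite in_qpoly_small // mk_monic_XnsubC size_M ltnS size_poly.
apply/existsP/idP => [[h /eqP/(congr1 (fun z : {poly %/ M} => z : {poly F}))]|/dvdpP[q cE]].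
  rewrite classE => -> /=; move: (polyn h) => {}h; 
  rewrite mk_monic_XnsubC -!(Pdiv.IdomainMonic.modpE monic_M).
  by rewrite -dvdp_mod // dvdp_mull // -dvdp_mod.
by exists (in_qpoly M q); rewrite /codeword_class cE in_qpolyM.
Qed.

Lemma rVpoly_constashift c :
  rVpoly (constashift lam c) = 'X * rVpoly c - c 0 (ord_pred (Ordinal N_gt0)) *: M.
Proof.
apply/polyP=> i; rewrite coefB coefXM coefZ coefB coefXn coefC.
have [lt_iN|] := ltnP i N.
  rewrite (coef_rVpoly_ord _ (Ordinal lt_iN)) mxE /= (ltn_eqF lt_iN) sub0r mulrN opprK.
  case: i lt_iN => [|i] lt_iN /=.
    by rewrite add0r mulrC; congr (c 0 _ * _); apply: val_inj.
  rewrite mulr0 addr0 mul1r (coef_rVpoly_ord _ (Ordinal (ltnW lt_iN))).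
  congr (c 0 _); apply: val_inj => /=.
  by rewrite modnDr modn_small // ltnW.
move=> le_Ni; rewrite nth_default ?(leq_trans (size_poly _ _)) //.
case: i le_Ni => [|i le_Ni]; first by rewrite leqn0 (gtn_eqF N_gt0).
rewrite /= subr0.
have [eq_iN|neq_iN] := eqVneq i.+1 N.
  have lt_iN : (i < N)%N by rewrite -eq_iN.
  rewrite mulr1 (coef_rVpoly_ord _ (Ordinal lt_iN)).
  have -> : ord_pred (Ordinal N_gt0) = Ordinal lt_iN; last by rewrite subrr.
  by apply: val_inj; rewrite /= -eq_iN modn_small.
rewrite mulr0 subr0 nth_default // (leq_trans (size_poly _ _)) //.
by rewrite -ltnS ltn_neqAle eq_sym neq_iN.
Qed.

(** The polynomials whose class lies in D form an ideal containing the modulus: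
    closure under the shift is closure under multiplication by X. By Bezout this
    ideal contains the gcd of the modulus and all the words of D. *)
Lemma cyclic_code_divisor D : cyclic_code lam D ->
  exists2 g, g %| M & D = ideal_code lam g.
Proof.
move=> [[D0 Dlin] Dshift].
have DD u v : u \in D -> v \in D -> u + v \in D.
  by move=> Du Dv; rewrite -[u]scale1r; apply: Dlin.
have DZ a u : u \in D -> a *: u \in D.
  by move=> Du; rewrite -[_ *: _]addr0; apply: Dlin.
pose I h := @poly_rV F N (h %% M) \in D.
have modK h : rVpoly (@poly_rV F N (h %% M)) = h %% M.
  by rewrite poly_rV_K // -ltnS -size_M ltn_modp.
have ID h h' : I h -> I h' -> I (h + h').
  by rewrite /I modpD linearD; apply: DD.
have IZ a h : I h -> I (a *: h) by rewrite /I modpZl linearZ; apply: DZ.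
have IrV c : I (rVpoly c) = (c \in D).
  by rewrite /I modp_small ?rVpolyK // size_M ltnS size_poly.
have IX h : I h -> I ('X * h).
  move=> /Dshift; rewrite -IrV rVpoly_constashift modK.
  have -> : 'X * h = 'X * (h %/ M) * M + 'X * (h %% M).
    by rewrite -mulrA -mulrDr -divp_eq.
  by rewrite /I !modpD modpN modpZl modpp scaler0 subr0 modp_mull add0r.
have IM h h' : I h' -> I (h * h').
  move=> Ih'; elim/poly_ind: h => [|h a IHh].
    by rewrite mul0r /I mod0p linear0.
  rewrite mulrDl mul_polyC; apply: ID; last exact: IZ.
  by rewrite mulrAC mulrC; apply: IX.
have Igcd h h' : I h -> I h' -> I (gcdp h h').
  move=> Ih Ih'; have [[u v] /=] := Bezoutp h h'; rewrite eqp_sym => /eqpfP->.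
  by apply/IZ/ID; apply: IM.
pose G s := foldr (fun c => gcdp (rVpoly c)) M s.
have IG s : {subset s <= D} -> I (G s).
  elim: s => [|c s IHs] sD /=; first by rewrite /I modpp linear0.
  apply: Igcd; first by rewrite IrV sD ?mem_head.
  by apply: IHs => x sx; rewrite sD // inE sx orbT.
have G_M s : G s %| M.
  by elim: s => [|c s IHs] /=; [apply: dvdpp | apply: dvdp_trans (dvdp_gcdr _ _) IHs].
have G_s s c : c \in s -> G s %| rVpoly c.
  elim: s => //= x s IHs; rewrite inE => /orP[/eqP->|/IHs]; first exact: dvdp_gcdl.
  exact: dvdp_trans (dvdp_gcdr _ _).
exists (G (enum D)) => //; apply/setP => c; rewrite mem_ideal_code //.
apply/idP/idP => [Dc|/dvdpP[q cE]]; first by rewrite G_s // mem_enum.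
by rewrite -IrV cE; apply/IM/IG => x; rewrite mem_enum.
Qed.

Lemma eqp_ideal_code g h : g %| M -> g %= h ->
  ideal_code lam g = ideal_code lam h :> {set 'rV[F]_N}.
Proof.
move=> dvd_gM eq_gh; apply/setP => c.
by rewrite !mem_ideal_code ?(eqp_dvdl _ eq_gh) // -(eqp_dvdl _ eq_gh).
Qed.

Lemma hamming_weight_rVpoly c : hamming_weight c = weight (rVpoly c).
Proof.
rewrite (@weightE _ N) ?size_poly // /hamming_weight -sum1_card big_mkcond /=.
by apply: eq_bigr => i _; rewrite inE coef_rVpoly_ord; case: (_ != 0).
Qed.

(** The default value N of the minimum is harmless: the word provided by the
    upper bound has weight at most N. *)
Lemma hamming_distance_ideal_code g v : g %| M ->
    min_weight_ge N g v -> min_weight_le N g v ->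
  hamming_distance (ideal_code lam g : {set 'rV[F]_N}) = v.
Proof.
move=> dvd_gM ge_v [c [c_neq0 le_c dvd_c le_v]].
have cK := poly_rV_K le_c.
apply/eqP; rewrite eqn_leq; apply/andP; split.
  apply: leq_trans le_v; rewrite -cK -hamming_weight_rVpoly.
  apply: bigminn_leq; rewrite ?mem_index_enum // mem_ideal_code // cK dvd_c /=.
  by apply: contraNneq c_neq0 => c0; rewrite -cK c0 linear0.
rewrite /hamming_distance; elim/big_rec: _ => [|x w /andP[Cx x_neq0] le_vw].
  exact: leq_trans (leq_trans (ge_v _ c_neq0 le_c dvd_c) (weight_le_size _)) le_c.
rewrite leq_min le_vw andbT hamming_weight_rVpoly ge_v ?size_poly //.
  by apply: contraNneq x_neq0 => x0; rewrite -[x]rVpolyK x0 linear0.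
by rewrite -mem_ideal_code.
Qed.

End ConstacyclicCodes.

(** * The minimal weight as a function of the exponents *)

Section NonzeroRoots.
Variables (F : fieldType) (p s : nat).
Hypothesis pcharF : p \in [pchar F].

(** The roots xi^2 and - xi, and their analogues when xi is replaced by - xi, are
    all needed; the bounds are the same for every nonzero root. *)
Definition root_weight_ge i v :=
  forall a : F, a != 0 -> min_weight_ge (p ^ s) (('X - a%:P) ^+ i) v.

Definition root_weight_le i v :=
  forall a : F, a != 0 -> min_weight_le (p ^ s) (('X - a%:P) ^+ i) v.

Lemma root_weight_le_leq i T v : (i <= T)%N -> root_weight_le T v -> root_weight_le i v.
Proof.
move=> le_iT le_v a a_neq0; apply: min_weight_le_dvdp (le_v a a_neq0).
exact: dvdp_exp2l.
Qed.

Lemma root_weight_ge_subblock k t i : (k < s)%N -> (0 < t <= p)%N ->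
    (p ^ s - p ^ (s - k) + (t - 1) * p ^ (s - k - 1) < i)%N ->
  root_weight_ge i ((t + 1) * p ^ k).
Proof. by move=> lt_ks t_in lt_i a a_neq0; apply: min_weight_ge_power. Qed.

Lemma root_weight_le_subblock k t : (k < s)%N -> (t < p)%N ->
  root_weight_le (p ^ s - p ^ (s - k) + t * p ^ (s - k - 1)) ((t + 1) * p ^ k).
Proof. by move=> lt_ks lt_tp a a_neq0; apply: min_weight_le_power. Qed.

(** A block is the range k = 0, t = b + 1. *)
Lemma root_weight_ge_block b i : (0 < s)%N -> (b < p)%N ->
  (b * p ^ (s - 1) < i)%N -> root_weight_ge i (b + 2).
Proof.
move=> s_gt0 lt_bp lt_i; have := @root_weight_ge_subblock 0 b.+1 i s_gt0 lt_bp.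
by rewrite subn0 subnn add0n expn0 muln1 (subn1 b.+1) addn1 addn2; apply.
Qed.

Lemma root_weight_le_block b : (0 < s)%N -> (b.+1 < p)%N ->
  root_weight_le ((b + 1) * p ^ (s - 1)) (b + 2).
Proof.
move=> s_gt0 lt_bp; have := root_weight_le_subblock s_gt0 lt_bp.
by rewrite subn0 subnn add0n expn0 muln1 !addn1 addn2.
Qed.

(** A bound u attained by a power of X - xi^2 divisible by both factors is needed
    only when u is the smaller of the two candidates. *)
Lemma min_weight_two_roots (xi : F) i j u w :
    xi != 0 -> 2%:R != 0 :> F -> (i <= p ^ s)%N -> (w <= u)%N ->
    root_weight_ge i u -> root_weight_ge j w -> root_weight_le j w ->
    ((u < 2 * w)%N -> exists T, [/\ (i <= T)%N, (j <= T)%N & root_weight_le T u]) ->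
  let h := ('X - xi%:P) ^+ i * ('X + xi%:P) ^+ j in
  min_weight_ge (2 * p ^ s) h (minn u (2 * w)) /\
  min_weight_le (2 * p ^ s) h (minn u (2 * w)).
Proof.
move=> xi_neq0 two_neq0 le_iq le_wu ge_u ge_w le_w le_u h.
have xi2_neq0 : xi ^+ 2 != 0 by rewrite expf_neq0.
split; first by apply: min_weight_ge_two_roots => //; [apply: ge_u | apply: ge_w].
case: (leqP (2 * w) u) => [le_2wu|/le_u[T [le_iT le_jT le_Tu]]].
  by apply: min_weight_le_double => //; apply: le_w; rewrite oppr_eq0.
by apply: (min_weight_le_two_roots le_iT le_jT); apply: le_Tu.
Qed.

End NonzeroRoots.

(** * Classification and distances *)

Theorem theorem8p22 (p m s eta : nat) (F : finFieldType) (lam xi psi : F)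
  (p_prime : prime p) (p_odd : odd p)
  (m_gt0 : (0 < m)%N) (s_gt0 : (0 < s)%N) (eta_gt0 : (0 < eta)%N)
  (cardF : #|F| = (p ^ m)%N)
  (lam_neq0 : lam != 0) (xi_neq0 : xi != 0) (psi_neq0 : psi != 0)
  (lamE : lam = psi ^+ (p ^ s))
  (irr1 : irreducible_poly ('X^eta - xi%:P))
  (irr2 : irreducible_poly ('X^eta + xi%:P))
  (factorization :
     'X^(2 * eta) - psi%:P = ('X^eta - xi%:P) * ('X^eta + xi%:P)) :
  let N := (2 * eta * p ^ s)%N in
  let C (i j : nat) : {set 'rV[F]_N} :=
    ideal_code lam (('X^eta - xi%:P) ^+ i * ('X^eta + xi%:P) ^+ j) in
  let d (i j : nat) : nat := hamming_distance (C i j) in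
  (* the same value for (i, j) and for (j, i) *)
  let d_sym (i j v : nat) : Prop := d i j = v /\ d j i = v in
  let block (b i : nat) : bool :=
    (b * p ^ (s - 1) + 1 <= i <= (b + 1) * p ^ (s - 1))%N in
  let subblock (k t i : nat) : bool :=
    (p ^ s - p ^ (s - k) + (t - 1) * p ^ (s - k - 1) + 1 <= i
       <= p ^ s - p ^ (s - k) + t * p ^ (s - k - 1))%N in
  [/\ forall D : {set 'rV[F]_N}, cyclic_code lam D ->
        exists i j : nat, [/\ (i <= p ^ s)%N, (j <= p ^ s)%N & D = C i j],
      C 0%N 0%N = [set: 'rV[F]_N],
      C (p ^ s)%N (p ^ s)%N = [set 0] &
      forall i j : nat, (i <= p ^ s)%N -> (j <= p ^ s)%N ->
        (i, j) != (0%N, 0%N) -> (i, j) != (p ^ s, p ^ s)%N ->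
        (* case 1 *)
        ((0 < i <= p ^ s)%N -> j = 0%N -> d_sym i j 2%N) /\
        (* case 2 *)
        ((i <= p ^ (s - 1))%N -> (j <= p ^ (s - 1))%N -> d i j = 2%N) /\
        (* case 3 *)
        ((p ^ (s - 1) < i <= 2 * p ^ (s - 1))%N ->
           (0 < j <= p ^ (s - 1))%N -> d_sym i j 3%N) /\
        (* case 4 *)
        ((2 * p ^ (s - 1) < i <= p ^ s)%N ->
           (0 < j <= p ^ (s - 1))%N -> d_sym i j 4%N) /\
        (* case 5 *)
        (forall b b' : nat, (1 <= b')%N -> (b' <= b)%N -> (b <= p - 2)%N ->
           block b i -> block b' j ->
           d_sym i j (minn (b + 2) (2 * (b' + 2)))) /\
        (* case 6 *)
        (forall k t b : nat, (1 <= k <= s - 1)%N -> (1 <= t <= p - 1)%N ->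
           (1 <= b <= p - 2)%N ->
           subblock k t i -> block b j -> d_sym i j (2 * (b + 2))%N) /\
        (* case 7 *)
        (forall k t : nat, (1 <= k <= s - 1)%N -> (1 <= t <= p - 1)%N ->
           subblock k t i -> subblock k t j -> d i j = ((t + 1) * p ^ k)%N) /\
        (* case 8 *)
        (forall k t1 t2 : nat, (1 <= k <= s - 1)%N ->
           (1 <= t2)%N -> (t2 < t1)%N -> (t1 <= p - 1)%N ->
           subblock k t1 i -> subblock k t2 j ->
           d_sym i j (minn (2 * (t2 + 1) * p ^ k) ((t1 + 1) * p ^ k))) /\
        (* case 9 *)
        (forall k' k'' t3 t4 : nat,
           (1 <= k'')%N -> (k'' < k')%N -> (k' <= s - 1)%N ->
           (1 <= t3 <= p - 1)%N -> (1 <= t4 <= p - 1)%N ->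
           subblock k' t3 i -> subblock k'' t4 j ->
           d_sym i j (2 * (t4 + 1) * p ^ k'')%N) /\
        (* case 10 *)
        (forall b : nat, (1 <= b <= p - 2)%N ->
           i = (p ^ s)%N -> block b j -> d_sym i j (2 * (b + 2))%N) /\
        (* case 11 *)
        (forall k t : nat, (1 <= k <= s - 1)%N -> (1 <= t <= p - 1)%N ->
           i = (p ^ s)%N -> subblock k t j ->
           d_sym i j (2 * (t + 1) * p ^ k)%N)].
Proof.
move=> N C d d_sym block subblock.
have pcharF : p \in [pchar F] by apply: card_finPcharP cardF p_prime.
have p_gt2 : (2 < p)%N by apply: odd_prime_gt2.
have two_neq0 : 2%:R != 0 :> F by rewrite -(dvdn_pcharf pcharF) gtnNdvd.
have q_gt0 : (0 < p ^ s)%N by rewrite expn_gt0 prime_gt0.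
have N_gt0 : (0 < N)%N by rewrite !muln_gt0 eta_gt0.
pose f := 'X^eta - xi%:P; pose g := 'X^eta + xi%:P.
have ME : 'X^N - lam%:P = f ^+ (p ^ s) * g ^+ (p ^ s).
  rewrite -exprMn -factorization (Frobenius_polyB pcharF) -exprM lamE.
  by rewrite polyC_exp.
have dvd_M i j : (i <= p ^ s)%N -> (j <= p ^ s)%N ->
    f ^+ i * g ^+ j %| 'X^N - lam%:P.
  by move=> le_i le_j; rewrite ME; apply: dvdp_mul; apply: dvdp_exp2l.
have dE i j v : (i <= p ^ s)%N -> (j <= p ^ s)%N ->
    let h := ('X - xi%:P) ^+ i * ('X + xi%:P) ^+ j in
    min_weight_ge (2 * p ^ s) h v /\ min_weight_le (2 * p ^ s) h v -> d i j = v.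
  move=> le_i le_j h [ge_v le_v].
  have NE : N = (2 * p ^ s * eta)%N by rewrite mulnAC.
  have hE : h \Po 'X^eta = f ^+ i * g ^+ j.
    by rewrite rmorphM /= !rmorphXn /= comp_polyB comp_polyD comp_polyX comp_polyC.
  apply: hamming_distance_ideal_code => //; first exact: dvd_M.
    by rewrite NE -hE; apply: min_weight_ge_comp_Xn.
  by rewrite NE -hE; apply: min_weight_le_comp_Xn.
(* The interchanged exponents are obtained by replacing xi by - xi. *)
have key i j u w : (i <= p ^ s)%N -> (j <= p ^ s)%N -> (w <= u)%N ->
    root_weight_ge F p s i u -> root_weight_ge F p s j w -> root_weight_le F p s j w ->
    ((u < 2 * w)%N ->
       exists T, [/\ (i <= T)%N, (j <= T)%N & root_weight_le F p s T u]) ->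
  d_sym i j (minn u (2 * w)).
  move=> le_i le_j le_wu ge_u ge_w le_w le_u; split; apply: dE => //.
    exact: min_weight_two_roots.
  have Nxi_neq0 : - xi != 0 by rewrite oppr_eq0.
  have := min_weight_two_roots pcharF Nxi_neq0 two_neq0 le_i le_wu ge_u ge_w le_w le_u.
  by rewrite polyCN opprK mulrC.
split.
- move=> D /(cyclic_code_divisor N_gt0)[h dvd_h DE].
  have := dvd_h; rewrite ME => /(dvdp_exp2_irreducible irr1 irr2).
  move=> [i [j [le_i le_j eq_h]]]; exists i, j; split => //.
  by rewrite DE; apply: eqp_ideal_code.
- apply/setP => c; rewrite mem_ideal_code ?dvd_M // !expr0 mulr1 dvd1p.
  by rewrite inE.
- apply/setP => c; rewrite mem_ideal_code ?dvd_M // inE -ME.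
  apply/idP/eqP => [dv|->]; last by rewrite linear0 dvdp0.
  have [c0|c_neq0] := eqVneq (rVpoly c) 0; first by rewrite -[c]rVpolyK c0 linear0.
  have := dvdp_leq c_neq0 dv; rewrite size_XnsubC // => lt_N.
  by have := leq_trans lt_N (size_poly _ _); rewrite ltnn.
move=> i j le_i le_j ij_neq0 ij_neqq.
pose Q := (p ^ (s - 1))%N.
have Q_gt0 : (0 < Q)%N by rewrite expn_gt0 prime_gt0.
have ge_block b i' : (b < p)%N -> (b * Q < i')%N -> root_weight_ge F p s i' (b + 2).
  exact: root_weight_ge_block.
have le_block b i' : (b.+1 < p)%N -> (i' <= (b + 1) * Q)%N ->
    root_weight_le F p s i' (b + 2).
  by move=> lt_b le_i'; apply: root_weight_le_leq le_i' _; apply: root_weight_le_block.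
have p_gt1 := ltnW p_gt2.
have p_gt0 := ltnW p_gt1.
have dist_two i' : (0 < i' <= p ^ s)%N -> d_sym i' 0%N 2%N.
  case/andP=> i'_gt0 le_i'; apply: (key i' 0%N 2%N 1%N) => //.
  - by apply: (ge_block 0%N).
  - by move=> a a_neq0 c c_neq0 _ _; rewrite weight_gt0.
  - move=> a a_neq0; exists 1; rewrite expr0 oner_eq0 dvdpp size_poly1; split => //.
    by rewrite (leq_trans (weight_le_size _)) // size_poly1.
have lt_ks k : (1 <= k <= s - 1)%N -> (k < s)%N by clear -s_gt0; lia.
have t_lt t : (1 <= t <= p - 1)%N -> (t < p)%N by clear -p_gt0; lia.
have b_lt b : (b <= p - 2)%N -> (b.+1 < p)%N by clear -p_gt2; lia.
have sub_ge k t i' : (1 <= k <= s - 1)%N -> (1 <= t <= p - 1)%N -> subblock k t i' ->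
    root_weight_ge F p s i' ((t + 1) * p ^ k).
  move=> k_in t_in /andP[]; rewrite addn1 => lt_i _.
  apply: (root_weight_ge_subblock pcharF) lt_i; first exact: lt_ks.
  by have lt_tp := t_lt t t_in; case/andP: t_in => -> _; rewrite ltnW.
have sub_le k t i' i'' : (1 <= k <= s - 1)%N -> (1 <= t <= p - 1)%N -> subblock k t i' ->
    (i'' <= i')%N -> root_weight_le F p s i'' ((t + 1) * p ^ k).
  move=> k_in t_in /andP[_ le_i'] le_i''.
  apply: root_weight_le_leq (leq_trans le_i'' le_i') _.
  apply: (root_weight_le_subblock pcharF); [exact: lt_ks | exact: t_lt].
have block_ge b i' : (b <= p - 2)%N -> block b i' -> root_weight_ge F p s i' (b + 2).
  by move=> /b_lt/ltnW lt_b /andP[]; rewrite addn1 => lt_i' _; apply: ge_block.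
have block_le b i' : (b <= p - 2)%N -> block b i' -> root_weight_le F p s i' (b + 2).
  by move=> /b_lt lt_b /andP[_]; apply: le_block.
have top_ge v : root_weight_ge F p s (p ^ s) v.
  by move=> a a_neq0; apply: min_weight_ge_top.
split; first by move=> i_in ->; apply: dist_two.
split.
  move=> le_iQ le_jQ; case: (posnP j) => [j0|j_gt0].
    have i_gt0 : (0 < i)%N by rewrite lt0n; move: ij_neq0; rewrite j0 xpair_eqE andbT.
    by rewrite j0; apply: (dist_two i _).1; rewrite i_gt0.
  case: (posnP i) => [->|i_gt0]; first by apply: (dist_two j _).2; rewrite j_gt0.
  apply: (key i j 2%N 2%N _ _ _ _ _ _ _).1 => //; try exact: (ge_block 0%N).
    by apply: (le_block 0%N); rewrite ?mul1n.
  by move=> _; exists Q; split => //; apply: (le_block 0%N); rewrite ?mul1n.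
split.
  move=> /andP[lt_Qi le_i2Q] /andP[j_gt0 le_jQ].
  apply: (key i j 3%N 2%N) => //.
  - by apply: (ge_block 1%N); rewrite ?mul1n.
  - exact: (ge_block 0%N).
  - by apply: (le_block 0%N); rewrite ?mul1n.
  - move=> _; exists (2 * Q)%N; split => //; last exact: (le_block 1%N).
    by rewrite (leq_trans le_jQ) // leq_pmull.
split.
  move=> /andP[lt_2Qi _] /andP[j_gt0 le_jQ].
  apply: (key i j 4%N 2%N) => //.
  (* Only the lower bound matters for i, which may lie beyond the block 2. *)
  - exact: (ge_block 2%N).
  - exact: (ge_block 0%N).
  - by apply: (le_block 0%N); rewrite ?mul1n.
split.
  move=> b b' b'_gt0 le_b'b le_b bi bj.
  have le_b' := leq_trans le_b'b le_b; apply: key => //.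
  - by rewrite leq_add2r.
  - exact: block_ge.
  - exact: block_ge.
  - exact: block_le.
  - move=> _; exists ((b + 1) * Q)%N; case/andP: bi => _ le_iT; case/andP: bj => _ le_jT.
    split => //; last by apply: le_block; rewrite ?b_lt.
    by rewrite (leq_trans le_jT) // leq_mul2r leq_add2r le_b'b orbT.
(* When 2 w <= u no upper bound attached to the larger exponent is needed. *)
have double i' j' u w : (i' <= p ^ s)%N -> (j' <= p ^ s)%N -> (0 < w)%N ->
    (2 * w <= u)%N ->
    root_weight_ge F p s i' u -> root_weight_ge F p s j' w ->
    root_weight_le F p s j' w -> d_sym i' j' (2 * w)%N.
  move=> le_i' le_j' w_gt0 le_2wu ge_u ge_w le_w.
  rewrite -(minn_idPr le_2wu); apply: key => //.
    by apply: leq_trans le_2wu; rewrite leq_pmull.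
  by rewrite ltnNge le_2wu.
split.
  move=> k t b k_in t_in /andP[_ le_b] si bj.
  apply: double (sub_ge _ _ _ k_in t_in si) _ _ => //.
  - by rewrite addn2.
  - apply: leq_mul; first by rewrite addn1 ltnS; case/andP: t_in.
    apply: (@leq_trans p); first by rewrite addn2 b_lt.
    by rewrite -{1}(expn1 p) leq_exp2l //; case/andP: k_in.
  - exact: block_ge.
  - exact: block_le.
split.
  move=> k t k_in t_in si sj.
  have := key i j _ _ le_i le_j (leqnn _) (sub_ge _ _ _ k_in t_in si)
    (sub_ge _ _ _ k_in t_in sj) (sub_le _ _ _ _ k_in t_in sj (leqnn j)).
  rewrite (minn_idPl _) ?leq_pmull //; case=> // _.
  exists (p ^ s - p ^ (s - k) + t * p ^ (s - k - 1))%N.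
  case/andP: si => _ le_iT; case/andP: sj => _ le_jT; split => //.
  by apply: (root_weight_le_subblock pcharF); [exact: lt_ks | exact: t_lt].
split.
  move=> k t1 t2 k_in t2_gt0 lt_t t1_le si sj.
  have t1_in : (1 <= t1 <= p - 1)%N by rewrite t1_le andbT (leq_trans t2_gt0) // ltnW.
  have t2_in : (1 <= t2 <= p - 1)%N by rewrite t2_gt0 (leq_trans (ltnW lt_t)).
  rewrite minnC -mulnA; apply: (key i j _ _ le_i le_j _ (sub_ge _ _ _ k_in t1_in si)
    (sub_ge _ _ _ k_in t2_in sj) (sub_le _ _ _ _ k_in t2_in sj (leqnn j))).
    by rewrite leq_mul2r leq_add2r ltnW ?orbT.
  move=> _; exists (p ^ s - p ^ (s - k) + t1 * p ^ (s - k - 1))%N.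
  case/andP: si => _ le_iT; case/andP: sj => _ le_jT; split => //.
    by rewrite (leq_trans le_jT) // leq_add2l leq_mul2r ltnW ?orbT.
  by apply: (root_weight_le_subblock pcharF); [exact: lt_ks | exact: t_lt].
split.
  move=> k' k'' t3 t4 k''_gt0 lt_k k'_le t3_in t4_in si sj.
  have k'_in : (1 <= k' <= s - 1)%N by rewrite k'_le andbT (leq_trans k''_gt0) // ltnW.
  have k''_in : (1 <= k'' <= s - 1)%N by rewrite k''_gt0 (leq_trans (ltnW lt_k)).
  rewrite -mulnA; apply: double (sub_ge _ _ _ k'_in t3_in si)
    (sub_ge _ _ _ k''_in t4_in sj) _ => //.
  - by rewrite muln_gt0 addn1 expn_gt0 p_gt0.
  - apply: leq_mul; first by rewrite addn1 ltnS; case/andP: t3_in.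
    apply: (@leq_trans (p ^ k''.+1)); last by rewrite leq_exp2l.
    by rewrite expnS leq_mul2r addn1 t_lt ?orbT.
  - exact: sub_le sj (leqnn j).
split.
  (* For i = p ^ s any lower bound holds, in particular the one that is needed. *)
  move=> b /andP[_ le_b] iE bj; apply: (double i j (2 * (b + 2))%N) => //.
  - by rewrite addn2.
  - by rewrite iE.
  - exact: block_ge.
  - exact: block_le.
move=> k t k_in t_in iE sj; rewrite -mulnA.
apply: (double i j (2 * ((t + 1) * p ^ k))%N) => //.
- by rewrite muln_gt0 addn1 expn_gt0 p_gt0.
- by rewrite iE.
- exact: sub_ge.
- exact: sub_le sj (leqnn j).
Qed.
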